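(* Let $\mathbf K=\{K_t\}_{t\in T}$ be a simplicial filtration and let $q\in\mathbb N$. Then, for any $t_1\le t_2\le t_3$ in $T$ and each $k=1,\dots,n_q^{K_{t_1}}$, $$\lambda_{q,\mathrm{up},k}^{t_1,t_2}\le\lambda_{q,\mathrm{up},k}^{t_1,t_3}\qquad\text{and}\qquad\lambda_{q,\mathrm{up},k}^{t_2,t_3}\le\lambda_{q,\mathrm{up},k}^{t_1,t_3}.$$
   Context: A simplicial complex $K$ over a finite totally ordered set $V$ is a collection of nonempty subsets of $V$ closed under taking nonempty subsets. $S_q^K$ is the set of $q$-simplices (elements of cardinality $q+1$) and $n_q^K=|S_q^K|$. Every complex $K$ carries a weight function $w^K:K\to(0,\infty)$. For $\sigma\in S_q^K$, $[\sigma]$ is $\sigma$ oriented by the order of $V$. $C_q^K$ is the real vector space with basis $\{[\sigma]:\sigma\in S_q^K\}$ (and $C_{-1}^K=0$), with the inner product $\langle[\sigma],[\sigma']\rangle=\delta_{\sigma\sigma'}\,(w^K(\sigma))^{-1}$. The boundary operator is $\partial_q^K[v_0,\dots,v_q]=\sum_{i=0}^q(-1)^i[v_0,\dots,\hat v_i,\dots,v_q]$ for $q\ge1$, and $\partial_0^K=0$. A simplicial pair $K\hookrightarrow L$ consists of simplicial complexes $K\subseteq L$ over the same $V$ with $w^K=w^L|_K$. Put $C_{q}^{L,K}=\{c\in C_q^L:\partial_q^L c\in C_{q-1}^K\}$, with the inner product restricted from $C_q^L$, and let $\partial_q^{L,K}:C_q^{L,K}\to C_{q-1}^K$ be the restriction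 of $\partial_q^L$. The up persistent Laplacian is $\Delta_{q,\mathrm{up}}^{K,L}=\partial_{q+1}^{L,K}(\partial_{q+1}^{L,K})^*$ on $C_q^K$ ($*$ denotes adjoint). A simplicial filtration $\mathbf K=\{K_t\}_{t\in T}$, $T\subseteq\mathbb R$, is a family of simplicial complexes over the same finite ordered set $V$ such that $K_s\hookrightarrow K_t$ is a simplicial pair for all $s\le t$ in $T$. $\lambda_{q,\mathrm{up},k}^{s,t}$ denotes the $k$-th smallest eigenvalue (with multiplicity) of $\Delta_{q,\mathrm{up}}^{K_s,K_t}$. *)

(* Defs.v *)
From HB Require Import structures.
From mathcomp Require Import all_boot all_order all_algebra.
From mathcomp Require Import boolp classical_sets reals.
From mathcomp Require Import polyrcf.

Set Implicit Arguments.
Unset Strict Implicit.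
Unset Printing Implicit Defensive.

Import Order.TTheory GRing.Theory Num.Theory passmx.
Local Open Scope ring_scope.

Section LinearAlgebra.
Variable R : realType.

(** [adjoint ipU ipV f] is the operator [g] with [<f u, v> = <u, g v>]. It
    exists and is unique when [U] and [V] carry inner products ([adjointP],
    [adjoint_unique]); the default value 0 is only used for other forms. *)
Definition adjoint (U V : vectType R) (ipU : U -> U -> R) (ipV : V -> V -> R)
    (f : 'Hom(U, V)) : 'Hom(V, U) :=
  xget 0 [set g : 'Hom(V, U) | forall u v, ipV (f u) v = ipU u (g v)]%classic.

(** The real eigenvalues of [f] in increasing order, each one repeated
    according to its multiplicity as a root of the characteristic polynomial.
    For a self-adjoint [f] the characteristic polynomial splits, and the list
    has [\dim U] entries. *)
Definition eigenvalues (U : vectType R) (f : 'End(U)) : seq R :=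
  let p := char_poly (mxof (vbasis fullv) (vbasis fullv) f) in
  sort <=%R (flatten [seq nseq (mup a p) a | a <- rootsR p]).

Lemma eigenvalues_perm (U : vectType R) (f : 'End(U)) (s : seq R) :
  char_poly (mxof (vbasis fullv) (vbasis fullv) f) = \prod_(a <- s) ('X - a%:P) ->
  perm_eq (eigenvalues f) s.
Proof.
rewrite /eigenvalues; set p := char_poly _ => pE.
have p0 : p != 0 by rewrite monic_neq0 // char_poly_monic.
rewrite perm_sort; apply/allP => a _ /=; apply/eqP.
rewrite count_flatten sumnE !big_map.
under eq_bigr => b _ do rewrite count_nseq /=.
have mupE : mup a p = count_mem a s by rewrite pE mu_prod_XsubC.
have rootE : (a \in rootsR p) = (a \in s).
  by rewrite -(roots_on_rootsR p0) pE root_prod_XsubC.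
have [as_|aNs] := boolP (a \in s).
  rewrite (bigD1_seq a) ?rootE ?uniq_roots //= eqxx mul1n mupE big1 ?addn0 //.
  by move=> b /negbTE->.
rewrite big_seq big1 ?(count_memPn aNs) // => b br.
by case: eqP => // ba; rewrite -rootE -ba br in aNs.
Qed.

Section AdjointTheory.
Variables (U V : vectType R) (ipU : U -> U -> R) (ipV : V -> V -> R).
Hypothesis ipU_sym : forall x y, ipU x y = ipU y x.
Hypothesis ipU_lin : forall x, linear (ipU x : U -> R^o).
Hypothesis ipU_pos : forall x, x != 0 -> 0 < ipU x x.
Hypothesis ipV_sym : forall x y, ipV x y = ipV y x.
Hypothesis ipV_lin : forall x, linear (ipV x : V -> R^o).

Lemma form_sum (W : vectType R) (h : W -> R^o) (hl : linear h)
    n (c : 'I_n -> R) (e : 'I_n -> W) :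
  h (\sum_i c i *: e i) = \sum_i c i * h (e i).
Proof.
pose hL : {linear W -> R^o} := HB.pack h (GRing.isLinear.Build _ _ _ _ h hl).
rewrite -[h]/(hL : W -> R^o) linear_sum.
by apply: eq_bigr => i _; rewrite linearZ.
Qed.

Lemma ipU_eq0 x : (forall y, ipU y x = 0) -> x = 0.
Proof.
move=> h; apply/eqP; apply/negPn/negP => /ipU_pos.
by rewrite h ltxx.
Qed.

Lemma adjoint_ex (f : 'Hom(U, V)) :
  exists g : 'Hom(V, U), forall u v, ipV (f u) v = ipU u (g v).
Proof.
set n := \dim (fullv : {vspace U}).
pose e := vbasis (fullv : {vspace U}).
pose t (x : U) : 'rV[R]_n := \row_i ipU e`_i x.
have tl : linear t by move=> a x y; apply/rowP => i; rewrite !mxE; exact: ipU_lin.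
pose tL : {linear U -> 'rV[R]_n} :=
  HB.pack t (GRing.isLinear.Build _ _ _ _ t tl).
pose r (v : V) : 'rV[R]_n := \row_i ipV (f e`_i) v.
have rl : linear r by move=> a x y; apply/rowP => i; rewrite !mxE; exact: ipV_lin.
pose rL : {linear V -> 'rV[R]_n} :=
  HB.pack r (GRing.isLinear.Build _ _ _ _ r rl).
have spanE (u : U) : u = \sum_i coord e i u *: e`_i.
  by apply: coord_vbasis; rewrite memvf.
have sumU u x : ipU u x = \sum_i coord e i u * ipU e`_i x.
  rewrite {1}(spanE u) ipU_sym (form_sum (ipU_lin x)).
  by apply: eq_bigr => i _; rewrite ipU_sym.
have sumV u v : ipV (f u) v = \sum_i coord e i u * ipV (f e`_i) v.
  rewrite {1}(spanE u) linear_sum.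
  under eq_bigr => i _ do rewrite linearZ.
  rewrite ipV_sym (form_sum (ipV_lin v)).
  by apply: eq_bigr => i _; rewrite ipV_sym.
pose F := linfun tL.
have kF : lker F = 0%VS.
  apply/eqP; rewrite -subv0; apply/subvP => x; rewrite memv_ker lfunE /= memv0.
  move=> /eqP tx0; apply/eqP; apply: ipU_eq0 => y; rewrite sumU big1 // => i _.
  by have /rowP/(_ i) := tx0; rewrite !mxE => ->; rewrite mulr0.
have imF : limg F = fullv.
  apply/eqP; rewrite eqEdim subvf /=.
  have := limg_ker_dim F fullv; rewrite kF capv0 dimv0 add0n => ->.
  by rewrite dimvf /dim /= mul1n.
exists (F^-1 \o linfun rL)%VF => u v.
rewrite sumV sumU; apply: eq_bigr => i _; congr (_ * _).
have : F ((F^-1 \o linfun rL)%VF v) = r v.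
  by rewrite comp_lfunE limg_lfunVK ?imF ?memvf // lfunE.
by rewrite lfunE /= => /rowP/(_ i); rewrite !mxE => ->.
Qed.

Lemma adjointP (f : 'Hom(U, V)) u v :
  ipV (f u) v = ipU u (adjoint ipU ipV f v).
Proof.
have := xgetPex (0 : 'Hom(V, U)) (adjoint_ex f).
exact.
Qed.

Lemma adjoint_unique (f : 'Hom(U, V)) (g : 'Hom(V, U)) :
  (forall u v, ipV (f u) v = ipU u (g v)) -> g = adjoint ipU ipV f.
Proof.
move=> gP; apply/lfunP => v; apply/eqP; rewrite -subr_eq0; apply/eqP.
apply: ipU_eq0 => y.
have := ipU_lin y (-1) (adjoint ipU ipV f v) (g v).
rewrite -gP -adjointP !scaleN1r addNr.
by rewrite [- _ + g v]addrC => <-.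
Qed.

End AdjointTheory.

End LinearAlgebra.

Section Complexes.
Variables (R : realType) (d : Order.disp_t) (V : finOrderType d).

(** Only the values of [weight] on the simplices are relevant. *)
Record wcomplex := WComplex {
  simplices :> {set {set V}};
  weight : {set V} -> R;
  simplex_neq0 : finset.set0 \notin simplices;
  simplex_closed : forall s t : {set V},
    s \in simplices -> t \subset s -> t != finset.set0 -> t \in simplices;
  weight_gt0 : forall s, s \in simplices -> 0 < weight s }.

Definition qsimplices (K : wcomplex) (q : nat) : {set {set V}} :=
  [set s in simplices K | #|s| == q.+1].

Definition simplicial_pair (K L : wcomplex) : Prop :=
  simplices K \subset simplices L /\
  forall s, s \in simplices K -> weight K s = weight L s.

(** The values of [K] outside [T] are irrelevant. *)
Definition simplicial_filtration (T : set R) (K : R -> wcomplex) : Prop :=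
  forall s t, T s -> T t -> s <= t -> simplicial_pair (K s) (K t).

(** All chain spaces are subspaces of the space of functions on the subsets of
    [V]; [oriented s] is the basis vector [[s]], for the orientation of [s]
    given by the order of [V]. In this way the chain spaces of a subcomplex are
    literally subspaces of those of the complex. *)
Local Notation ambient := {ffun {set V} -> R^o}.

Definition oriented (s : {set V}) : ambient := [ffun t => (t == s)%:R].

Definition chain (K : wcomplex) (q : nat) : {vspace ambient} :=
  <<[seq oriented s | s <- enum (qsimplices K q)]>>%VS.

(** The vertex [v] of [s = {v_0 < ... < v_q}] is [v_i] for [i] the number of
    vertices of [s] smaller than [v]; the boundary of a vertex is 0. *)
Definition boundary_simplex (s : {set V}) : ambient :=
  if (#|s| <= 1)%N then 0 else
  \sum_(v in s) (-1) ^+ #|[set u in s | (u < v)%O]| *: oriented (s :\ v).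

Definition boundary_fun (c : ambient) : ambient :=
  \sum_(s : {set V}) c s *: boundary_simplex s.

Lemma boundary_fun_linear : linear boundary_fun.
Proof.
move=> a x y; rewrite /boundary_fun scaler_sumr -big_split /=.
by apply: eq_bigr => s _; rewrite !ffunE scalerDl scalerA.
Qed.

HB.instance Definition _ :=
  GRing.isLinear.Build R ambient ambient _ boundary_fun boundary_fun_linear.

Definition boundary : 'End(ambient) := linfun boundary_fun.

Definition inner (K : wcomplex) (x y : ambient) : R :=
  \sum_(s in simplices K) x s * y s / weight K s.

(** The inner product of [K] on a subspace [U]. *)
Definition inner_on (K : wcomplex) (U : {vspace ambient}) (x y : subvs_of U) : R :=
  inner K (vsval x) (vsval y).

(** [pchain L K q] is the space of the chains of [C_{q+1}^L] whose boundary is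
    in [C_q^K]. *)
Definition pchain (L K : wcomplex) (q : nat) : {vspace ambient} :=
  (chain L q.+1 :&: boundary @^-1: chain K q)%VS.

(** The operator from [C_{q+1}^{L,K}] to [C_q^K]; [vsproj] only retypes the
    boundary, which is in [chain K q]. *)
Definition pboundary (L K : wcomplex) (q : nat) :
    'Hom(subvs_of (pchain L K q), subvs_of (chain K q)) :=
  (linfun (vsproj (chain K q)) \o boundary \o linfun vsval)%VF.

Lemma pboundaryE L K q (u : subvs_of (pchain L K q)) :
  vsval (pboundary L K q u) = boundary (vsval u).
Proof.
rewrite /pboundary !comp_lfunE !lfunE /= vsprojK //.
by have := subvsP u; rewrite memv_cap -memv_preim !lfunE => /andP[].
Qed.

Definition up_laplacian (K L : wcomplex) (q : nat) : 'End(subvs_of (chain K q)) :=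
  (pboundary L K q \o
   adjoint (@inner_on L (pchain L K q)) (@inner_on K (chain K q))
     (pboundary L K q))%VF.

(** The k-th smallest eigenvalue, counted from k = 1. *)
Definition up_eigenvalue (K L : wcomplex) (q k : nat) : R :=
  nth 0 (eigenvalues (up_laplacian K L q)) k.-1.

Lemma inner_on_sym K U (x y : subvs_of U) : inner_on K x y = inner_on K y x.
Proof. by apply: eq_bigr => s _; rewrite [_ * vsval y s]mulrC. Qed.

Lemma inner_on_linear K U (x : subvs_of U) :
  linear (inner_on K x : subvs_of U -> R^o).
Proof.
move=> a y z; rewrite /inner_on.
have -> : vsval (a *: y + z) = a *: vsval y + vsval z by exact: linearP.
rewrite /inner scaler_sumr -big_split /=.
apply: eq_bigr => s _; rewrite !ffunE mulrDr mulrDl.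
by congr (_ + _); rewrite -!mulrA mulrCA.
Qed.

Lemma chain_supp K q (x : ambient) s :
  x \in chain K q -> s \notin simplices K -> x s = 0.
Proof.
move=> /coord_span -> sK; rewrite sum_ffunE big1 // => i _.
rewrite ffunE -tnth_nth tnth_map !ffunE.
case: eqP => [sE|_]; last by rewrite scaler0.
have := mem_tnth i (enum_tuple (qsimplices K q)).
by rewrite -sE mem_enum inE (negbTE sK).
Qed.

Lemma inner_on_gt0 K q U (x : subvs_of U) : (U <= chain K q)%VS -> x != 0 ->
  0 < inner_on K x x.
Proof.
move=> UK x0; have xK : vsval x \in chain K q by exact: (subvP UK _ (subvsP x)).
have ge0 s : s \in simplices K -> 0 <= vsval x s * vsval x s / weight K s.
  by move=> sK; rewrite divr_ge0 ?(ltW (weight_gt0 sK)) // -expr2 sqr_ge0.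
rewrite lt_neqAle sumr_ge0 // andbT eq_sym; apply: contra x0 => /eqP h.
apply/eqP/val_inj/ffunP => s; rewrite [RHS]ffunE.
have [sK|sK] := boolP (s \in simplices K); last exact: chain_supp xK sK.
have /eqP := psumr_eq0P ge0 h sK.
by rewrite mulf_eq0 invr_eq0 (gt_eqF (weight_gt0 sK)) orbF mulf_eq0 orbb => /eqP.
Qed.

Lemma pboundary_adjointP K L q u v :
  inner_on K (pboundary L K q u) v =
  inner_on L u (adjoint (@inner_on L _) (@inner_on K _) (pboundary L K q) v).
Proof.
apply: (adjointP (@inner_on_sym L _) (@inner_on_linear L _) _
  (@inner_on_sym K _) (@inner_on_linear K _)).
by move=> x; apply: (@inner_on_gt0 L q.+1); exact: capvSl.
Qed.

End Complexes.

(* Main.v *)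
Require Import Defs.
From HB Require Import structures.
From mathcomp Require Import all_boot all_order all_algebra.
From mathcomp Require Import classical_sets reals.
From mathcomp Require Import complex.
From mathcomp Require Import ring lra.

Local Open Scope ring_scope.

(** Write D : U -> W for the boundary operator that defines the up Laplacian
    D D^* of a pair. Since <D D^* w, w> = |D^* w|^2, both inequalities reduce,
    by the min-max principle, to a comparison of quadratic forms. The principle
    is used in the following form: for a self-adjoint A, the number of
    eigenvalues that are at most b is the largest dimension of a subspace on
    which <A x, x> <= b |x|^2 ([rayleigh_subspace], [dim_rayleigh_le]). Thus the
    k-th eigenvalue of B is at most that of A as soon as, for every b, each
    subspace on which A satisfies this bound yields one for B whose dimension is
    not smaller ([nth_eigenvalues_le]).

    Enlarging the ambient complex from K_{t2} to K_{t3} keeps the codomain and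
    enlarges the domain U. If U1 is a subspace of U and D1 is the restriction of
    D, then D1^* is D^* followed by the orthogonal projection onto U1, so that
    |D1^* w| <= |D^* w| and the same subspace serves for both operators
    ([laplacian_eigenvalue_subdomain]).

    Shrinking the small complex from K_{t2} to K_{t1} replaces W by a subspace
    W1 and U by the full preimage U1 of W1. Here D1 D1^* is the Schur
    complement of D D^* with respect to W1: writing N for the projection onto
    the orthogonal complement of W1, the space U1 is the kernel of N D, hence
    its orthogonal complement is the image of D^* N. Therefore each w in W1 is
    the projection of some z in W with D^* z = D1^* w. If the
    form of D1 D1^* is at most b on a subspace S of W1, these z satisfy
    |D^* z|^2 = |D1^* w|^2 <= b |w|^2 <= b |z|^2, where b >= 0 unless S = 0; and
    the z that arise from the w in S form a subspace of W which projects onto S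
    ([laplacian_eigenvalue_subcodomain]). *)
Section UpLaplacianMonotonicity.

Set Implicit Arguments.
Unset Strict Implicit.
Unset Printing Implicit Defensive.
Import Order.TTheory GRing.Theory Num.Theory passmx.

(** * Inner products and adjoint operators *)
Section InnerProducts.
Variable R : realType.

Record innerProduct (U : vectType R) := InnerProduct {
  form :> U -> U -> R;
  form_sym : forall x y, form x y = form y x;
  form_lin : forall x, linear (form x : U -> R^o);
  form_gt0 : forall x, x != 0 -> 0 < form x x }.

Section Theory.
Variables (U : vectType R) (ip : innerProduct U).

Lemma formDr x y z : ip x (y + z) = ip x y + ip x z.
Proof. by have := form_lin ip x 1 y z; rewrite !scale1r. Qed.

Lemma form0r x : ip x 0 = 0.
Proof. by have := formDr x 0 0; rewrite addr0; lra. Qed.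

Lemma formZr a x y : ip x (a *: y) = a * ip x y.
Proof. by have := form_lin ip x a y 0; rewrite !addr0 form0r addr0. Qed.

Lemma formDl x y z : ip (y + z) x = ip y x + ip z x.
Proof. by rewrite form_sym formDr !(form_sym _ x). Qed.

Lemma formZl a x y : ip (a *: y) x = a * ip y x.
Proof. by rewrite form_sym formZr form_sym. Qed.

Lemma formBr x y z : ip x (y - z) = ip x y - ip x z.
Proof. by rewrite formDr -scaleN1r formZr mulN1r. Qed.

Lemma formBl x y z : ip (y - z) x = ip y x - ip z x.
Proof. by rewrite form_sym formBr !(form_sym _ x). Qed.

Lemma form_ge0 x : 0 <= ip x x.
Proof.
have [->|/(form_gt0 ip)/ltW//] := eqVneq x 0.
by rewrite form0r.
Qed.

Lemma form_eq0 x : (ip x x == 0) = (x == 0).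
Proof.
apply/idP/eqP => [|->]; last by rewrite form0r.
by apply: contraTeq => /(form_gt0 ip) /lt0r_neq0.
Qed.

Lemma form_inj x y : (forall z, ip z x = ip z y) -> x = y.
Proof.
move=> xy; apply/eqP; rewrite -subr_eq0 -form_eq0.
by rewrite formBr xy subrr.
Qed.

End Theory.

Definition subform (U : vectType R) (ip : innerProduct U) (X : {vspace U}) :
  innerProduct (subvs_of X).
Proof.
exists (fun x y => ip (vsval x) (vsval y)) => [x y|x a y z|x x0].
- exact: form_sym.
- by rewrite linearP; exact: form_lin.
- by apply: form_gt0; rewrite -(inj_eq val_inj) linear0 in x0.
Defined.

Definition adjoint_pair (U V : vectType R) (ipU : innerProduct U)
    (ipV : innerProduct V) (f : 'Hom(U, V)) (g : 'Hom(V, U)) :=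
  forall u v, ipV (f u) v = ipU u (g v).

Lemma adjoint_pairP (U V : vectType R) (ipU : innerProduct U)
    (ipV : innerProduct V) (f : 'Hom(U, V)) :
  adjoint_pair ipU ipV f (adjoint ipU ipV f).
Proof.
move=> u v; apply: adjointP; [exact: form_sym|exact: form_lin|
  exact: form_gt0|exact: form_sym|exact: form_lin].
Qed.

Section Adjoints.
Variables (U V : vectType R) (ipU : innerProduct U) (ipV : innerProduct V).
Variables (f : 'Hom(U, V)) (g : 'Hom(V, U)).
Hypothesis fg : adjoint_pair ipU ipV f g.

Lemma adjoint_pair_sym : adjoint_pair ipV ipU g f.
Proof. by move=> v u; rewrite form_sym -fg form_sym. Qed.

(** The orthogonal projection onto the image X of [g], which is the adjoint of
    the inclusion of X, splits [u] as x + y with x in X and y orthogonal to X.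
    Then y is in the kernel of [f], hence is orthogonal to [u] as well, and so
    y = 0. *)
Lemma orthogonal_ker_sub_limg u :
  (forall x, f x = 0 -> ipU u x = 0) -> exists v, u = g v.
Proof.
move=> uf; pose X := limg g; pose i : 'Hom(subvs_of X, U) := linfun vsval.
pose p := adjoint (subform ipU X) ipU i.
have irp : adjoint_pair (subform ipU X) ipU i p by exact: adjoint_pairP.
have ipu : i (p u) \in X by rewrite lfunE /= subvsP.
have orth x : x \in X -> ipU x (u - i (p u)) = 0.
  move=> xX; have iE y : i y = vsval y by rewrite lfunE.
  by rewrite -(vsprojK xX) formBr -[vsval (vsproj _ _)]iE irp /= !iE subrr.
have /uf : f (u - i (p u)) = 0.
  apply/eqP; rewrite -(form_eq0 ipV) fg form_sym orth //.
  exact: memv_img (memvf _).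
move=> uy0; suff /eqP : u - i (p u) == 0.
  move/eqP; rewrite subr_eq0 => /eqP uE.
  by have /memv_imgP[v _ vE] := ipu; exists v; rewrite uE.
by rewrite -(form_eq0 ipU) formBl uy0 orth ?subrr.
Qed.

End Adjoints.

(** * The spectral theorem *)
Section Spectral.
Variables (U : vectType R) (ip : innerProduct U) (A : 'End(U)).
Hypothesis A_sa : adjoint_pair ip ip A A.

(** Let a + ib be a complex root of the characteristic polynomial and X + iY an
    eigenvector for it, so that A X = a X - b Y and A Y = b X + a Y. Comparing
    <A X, Y> with <X, A Y> gives b (|X|^2 + |Y|^2) = 0, whence b = 0, and X or Y
    is a real eigenvector. *)
Lemma selfadjoint_eigenvector : (0 < \dim {:U})%N ->
  exists a v, v != 0 /\ A v = a *: v.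
Proof.
move=> dimU; set e := vbasis {:U}.
have eb : basis_of {:U} e := vbasisP _.
pose M := mxof e e A; pose c : {rmorphism R -> R[i]} := real_complex R.
have /closed_rootP[z] : size (char_poly (map_mx c M)) != 1%N.
  by rewrite size_char_poly eqSS -lt0n.
rewrite -eigenvalue_root_char => /eigenvalueP[w wE w0].
pose x := map_mx (@complex.Re R) w; pose y := map_mx (@complex.Im R) w.
pose a := complex.Re z; pose b := complex.Im z.
have ReM (u v : R[i]) :
    complex.Re (u * v) =
    complex.Re u * complex.Re v - complex.Im u * complex.Im v.
  by case: u v => ? ? [].
have ImM (u v : R[i]) :
    complex.Im (u * v) =
    complex.Im u * complex.Re v + complex.Re u * complex.Im v.
  by case: u v => ? ? [? ?]; rewrite /= addrC.
have xE : x *m M = a *: x - b *: y.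
  apply/rowP => j; have /rowP/(_ j) := wE.
  rewrite !mxE => /(congr1 (@complex.Re R)); rewrite raddf_sum ReM => <-.
  by apply: eq_bigr => i _; rewrite !mxE /= ReM /= mulr0 subr0.
have yE : y *m M = b *: x + a *: y.
  apply/rowP => j; have /rowP/(_ j) := wE.
  rewrite !mxE => /(congr1 (@complex.Im R)); rewrite raddf_sum ImM => <-.
  by apply: eq_bigr => i _; rewrite !mxE /= ImM /= mulr0 addr0.
pose X := vecof e x; pose Y := vecof e y.
have AX : A X = a *: X - b *: Y.
  by rewrite (hom_vecof e eb) xE linearB !linearZ.
have AY : A Y = b *: X + a *: Y.
  by rewrite (hom_vecof e eb) yE linearD !linearZ.
have XY0 : (X != 0) || (Y != 0).
  rewrite !(vecof_eq0 eb) -negb_and; apply: contra w0 => /andP[/eqP x0 /eqP y0].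
  apply/eqP/rowP => j; rewrite mxE.
  have /rowP/(_ j) := x0; have /rowP/(_ j) := y0; rewrite !mxE.
  by case: (w 0 j) => ? ? /= -> ->.
have := A_sa X Y; rewrite AX AY formBl formDr !formZl !formZr => bE.
have b0 : b = 0.
  have X_ge0 := form_ge0 ip X; have Y_ge0 := form_ge0 ip Y.
  have : b * (ip X X + ip Y Y) = 0 by lra.
  move/eqP; rewrite mulf_eq0 => /orP[/eqP//|/eqP XY].
  have : ip X X == 0 by apply/eqP; lra.
  have : ip Y Y == 0 by apply/eqP; lra.
  by rewrite !form_eq0 => Y0 X0; rewrite X0 Y0 in XY0.
move: AX AY; rewrite b0 !scale0r subr0 add0r => AX AY.
by case/orP: XY0 => nz; [exists a, X|exists a, Y].
Qed.

Definition eigensystem (l : seq (R * U)) :=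
  all (fun p => (p.2 != 0) && (A p.2 == p.1 *: p.2)) l &&
  pairwise (fun p r => ip p.2 r.2 == 0) l.

Lemma orthogonal_span v (s : seq U) x :
  (forall y, y \in s -> ip v y = 0) -> x \in <<s>>%VS -> ip v x = 0.
Proof.
move=> vs /(coord_span (X := in_tuple s)) ->.
rewrite (form_sum (form_lin ip v)) big1 // => i _.
by rewrite vs ?mulr0 // mem_nth.
Qed.

End Spectral.

Lemma eigensystem_cons (U : vectType R) (ip : innerProduct U) (A : 'End(U))
    a v l :
  eigensystem ip A ((a, v) :: l) ->
  [/\ v != 0, A v = a *: v, (forall y, y \in <<unzip2 l>>%VS -> ip v y = 0)
    & eigensystem ip A l].
Proof.
rewrite /eigensystem /= => /andP[/andP[/andP[v0 /eqP Av] lA] /andP[vl lp]].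
split=> //; last by rewrite lA.
move=> y; apply: orthogonal_span => _ /mapP[p pl ->].
exact/eqP/(allP vl).
Qed.

(** The statement is about stable subspaces, so that the induction on the
    dimension can pass from X to the orthogonal complement in X of an
    eigenvector. *)
Lemma spectral_theorem_stable (U : vectType R) (ip : innerProduct U)
    (A : 'End(U)) (X : {vspace U}) :
  adjoint_pair ip ip A A -> (A @: X <= X)%VS ->
  exists l, eigensystem ip A l /\ basis_of X (unzip2 l).
Proof.
move=> A_sa; have [n] := ubnP (\dim X).
elim: n X => // n IHn X dimX AX.
have [X0|dimX_gt0] := posnP (\dim X).
  exists [::]; split=> //.
  by apply/andP; split; rewrite ?nil_free // span_nil eq_sym -dimv_eq0 X0.
have AXP x : x \in X -> A x \in X by move=> xX; apply/(subvP AX)/memv_img.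
pose B : 'End(subvs_of X) := (linfun (vsproj X) \o A \o linfun vsval)%VF.
have BE x : vsval (B x) = A (vsval x).
  by rewrite !comp_lfunE !lfunE /= vsprojK // AXP // subvsP.
have [||a [w [w0 Bw]]] := @selfadjoint_eigenvector _ (subform ip X) B.
- by move=> x y; rewrite /= !BE A_sa.
- by rewrite dimvf.
pose v := vsval w; have vX : v \in X by exact: subvsP.
have v0 : v != 0 by rewrite -(inj_eq val_inj) linear0 in w0.
have Av : A v = a *: v by rewrite -BE Bw linearZ.
pose h : {linear U -> R^o} :=
  HB.pack (ip v : U -> R^o) (GRing.isLinear.Build _ _ _ _ _ (form_lin ip v)).
have hE x : linfun h x = ip v x by rewrite lfunE.
pose Y := (X :&: lker (linfun h))%VS.
have YP x : (x \in Y) = (x \in X) && (ip v x == 0).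
  by rewrite memv_cap memv_ker hE.
have vv0 : ip v v != 0 by rewrite form_eq0.
have XE : (<[v]> + Y)%VS = X.
  apply/vspaceP => x; apply/memv_addP/idP => [[_ /vlineP[c ->] [y]]|xX].
    by rewrite YP => /andP[yX _] ->; rewrite memvD // memvZ.
  exists ((ip v x / ip v v) *: v); first by rewrite memvZ // memv_line.
  exists (x - (ip v x / ip v v) *: v); last by rewrite addrC subrK.
  by rewrite YP memvB ?memvZ //= formBr formZr divfK // subrr.
have vY : v \notin Y by rewrite YP (negbTE vv0) andbF.
have [||l [lE lb]] := IHn Y.
- have ltYX : (\dim Y < \dim X)%N.
    rewrite ltn_neqAle dimvS ?capvSl // andbT.
    apply: contra vY => /eqP dimE.
    suff -> : Y = X by [].
    by apply/eqP; rewrite eqEdim capvSl dimE leqnn.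
  exact: leq_trans ltYX dimX.
- apply/subvP => _ /memv_imgP[x + ->]; rewrite !YP => /andP[xX /eqP vx].
  by rewrite AXP // -A_sa Av formZl vx mulr0 eqxx.
exists ((a, v) :: l); split.
  move/andP: lE => [lA lp]; rewrite /eigensystem /= v0 Av eqxx lA lp !andbT.
  apply/allP => p pl /=.
  have : p.2 \in Y by rewrite -(span_basis lb) memv_span // map_f.
  by rewrite YP => /andP[].
apply/andP; split; first by rewrite /= span_cons (span_basis lb) XE.
by rewrite /= free_cons (span_basis lb) vY (basis_free lb).
Qed.

(** [eigenvalues] is defined from the matrix in an arbitrary basis; the base
    change to the eigenbasis makes this matrix diagonal and does not change the
    characteristic polynomial. *)
Lemma eigenvalues_eigenbasis (U : vectType R) (ip : innerProduct U)
    (A : 'End(U)) l :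
  eigensystem ip A l -> basis_of fullv (unzip2 l) ->
  perm_eq (eigenvalues A) (unzip1 l).
Proof.
move=> /andP[lA _] lb; apply: eigenvalues_perm.
have sz : size (unzip2 l) == \dim {:U}.
  by case/andP: lb => /eqP <- /eqnP ->.
pose e : (\dim {:U}).-tuple U := Tuple sz.
have eb : basis_of {:U} e by [].
set b := vbasis fullv; have bb : basis_of {:U} b := vbasisP _.
pose P := mxof e b \1%VF; pose Q := mxof b e \1%VF.
have PQ : P *m Q = 1%:M.
  by rewrite -mxof_comp // comp_lfun1l mxof1 // (basis_free eb).
have PA : P *m mxof b b A = mxof e e A *m P.
  by rewrite -!mxof_comp // comp_lfun1l comp_lfun1r.
have -> : char_poly (mxof b b A) = char_poly (mxof e e A).
  pose Pp := map_mx polyC P; pose Qp := map_mx polyC Q.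
  have PQp : Pp *m Qp = 1%:M by rewrite -map_mxM PQ map_mx1.
  have : Pp *m char_poly_mx (mxof b b A) = char_poly_mx (mxof e e A) *m Pp.
    rewrite /char_poly_mx mulmxBr mulmxBl -!map_mxM PA.
    by rewrite mul_mx_scalar mul_scalar_mx.
  move=> /(congr1 (fun M => \det (M *m Qp))).
  rewrite -[in RHS]mulmxA PQp mulmx1 !det_mulmx mulrAC.
  by rewrite -det_mulmx PQp det1 mul1r.
have szl : size l = \dim {:U} by rewrite -(size_map snd l) (eqP sz).
have mE i j : mxof e e A i j = (nth (0, 0) l i).1 * (i == j)%:R.
  have il : (i < size l)%N by rewrite szl.
  rewrite !mxE /= vecof_delta.
  have eE : e`_i = (nth (0, 0) l i).2 by exact: nth_map.
  have /andP[_ /eqP] := allP lA _ (mem_nth (0, 0) il).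
  by rewrite -eE => ->; rewrite linearZ /= coord_free ?(basis_free eb).
rewrite char_poly_trig.
  rewrite big_map (big_nth (0, 0)) big_mkord szl.
  by apply: eq_bigr => i _; rewrite mE eqxx mulr1.
apply/is_trig_mxP => i j ij; rewrite mE.
by case: eqP ij => [->|_ _]; rewrite ?ltnn ?mulr0.
Qed.

(** * The min-max principle *)
Section Counting.
Variables (U : vectType R) (ip : innerProduct U) (A : 'End(U)).
Hypothesis A_sa : adjoint_pair ip ip A A.

(** The Rayleigh quotient of a span of orthogonal eigenvectors can be estimated
    one eigenvector at a time, because both quadratic forms split. *)
Lemma rayleigh_orthogonal_add a v y c : A v = a *: v -> ip v y = 0 ->
  ip (A (c *: v + y)) (c *: v + y) = a * (c ^+ 2 * ip v v) + ip (A y) y /\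
  ip (c *: v + y) (c *: v + y) = c ^+ 2 * ip v v + ip y y.
Proof.
move=> Av vy.
have Ayv : ip (A y) v = 0 by rewrite A_sa Av formZr form_sym vy mulr0.
have yv : ip y v = 0 by rewrite form_sym.
rewrite linearD linearZ /= Av !(formDl, formDr, formZl, formZr) Ayv yv vy.
by split; ring.
Qed.

Lemma rayleigh_le l b x : eigensystem ip A l -> all (<= b) (unzip1 l) ->
  x \in <<unzip2 l>>%VS -> ip (A x) x <= b * ip x x.
Proof.
elim: l x => [x _ _|[a v] l IHl x].
  by rewrite span_nil memv0 => /eqP ->; rewrite !form0r mulr0.
move=> /eigensystem_cons[v0 Av vl lE] /= /andP[ab lb].
rewrite span_cons => /memv_addP[_ /vlineP[c ->] [y yl ->]].
have [-> ->] := rayleigh_orthogonal_add c Av (vl _ yl).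
by rewrite mulrDr lerD ?IHl // ler_wpM2r // mulr_ge0 ?sqr_ge0 ?form_ge0.
Qed.

Lemma rayleigh_gt l b x : eigensystem ip A l -> all (> b) (unzip1 l) ->
  x \in <<unzip2 l>>%VS -> x != 0 -> b * ip x x < ip (A x) x.
Proof.
elim: l x => [x _ _|[a v] l IHl x].
  by rewrite span_nil memv0 => ->.
move=> /eigensystem_cons[v0 Av vl lE] /= /andP[ab lb].
rewrite span_cons => /memv_addP[_ /vlineP[c ->] [y yl ->]] cvy0.
have [-> ->] := rayleigh_orthogonal_add c Av (vl _ yl).
have [y0|y0] := eqVneq y 0.
  have c0 : c != 0 by apply: contraNneq cvy0 => ->; rewrite y0 scale0r addr0.
  rewrite y0 linear0 !form0r !addr0 ltr_pM2r //.
  by rewrite mulr_gt0 ?form_gt0 // exprn_even_gt0.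
rewrite mulrDr ler_ltD ?IHl // ler_wpM2r ?(ltW ab) //.
by rewrite mulr_ge0 ?sqr_ge0 ?form_ge0.
Qed.

Lemma eigensystem_filter l p :
  eigensystem ip A l -> eigensystem ip A (filter p l).
Proof.
case/andP=> lA lp; apply/andP; split; last exact: pairwise_filter.
by apply/allP => r; rewrite mem_filter => /andP[_]; exact: (allP lA).
Qed.

Lemma dim_span_filter (l : seq (R * U)) p :
  free (unzip2 l) -> \dim <<unzip2 (filter p l)>> = count p l.
Proof.
move=> lf; have /eqnP -> : free (unzip2 (filter p l)).
  have /perm_free :
      perm_eq (unzip2 (filter p l ++ filter (predC p) l)) (unzip2 l).
    by apply: perm_map; rewrite perm_filterC.
  by rewrite lf /unzip2 map_cat => /catl_free.
by rewrite size_map size_filter.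
Qed.

Lemma rayleigh_subspace b : exists S : {vspace U},
  \dim S = count (<= b) (eigenvalues A) /\
  forall x, x \in S -> ip (A x) x <= b * ip x x.
Proof.
have [l [lE lb]] := spectral_theorem_stable A_sa (subvf (A @: fullv)).
rewrite (permP (eigenvalues_eigenbasis lE lb)) count_map.
exists <<unzip2 (filter (fun p => (p.1 <= b)%R) l)>>%VS; split.
  by rewrite dim_span_filter // (basis_free lb).
move=> x; apply: rayleigh_le; first exact: eigensystem_filter.
by rewrite all_map filter_all.
Qed.

(** [S] meets the span of the eigenvectors for the eigenvalues above [b] only
    in 0, since there the opposite strict inequality holds; compare
    dimensions. *)
Lemma dim_rayleigh_le (S : {vspace U}) b :
  (forall x, x \in S -> ip (A x) x <= b * ip x x) ->
  (\dim S <= count (<= b)%R (eigenvalues A))%N.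
Proof.
move=> SA.
have [l [lE lb]] := spectral_theorem_stable A_sa (subvf (A @: fullv)).
rewrite (permP (eigenvalues_eigenbasis lE lb)) count_map.
set T := <<unzip2 (filter (fun p => ~~ (p.1 <= b)%R) l)>>%VS.
have ST : (S :&: T = 0)%VS.
  apply/eqP; rewrite -subv0; apply/subvP => x; rewrite memv_cap memv0.
  case/andP=> xS; apply: contraTT => x0; apply: contraL (SA x xS) => xT.
  rewrite -ltNge; apply: rayleigh_gt xT x0; first exact: eigensystem_filter.
  by rewrite all_map; apply/allP => p; rewrite mem_filter /= -ltNge => /andP[].
have := dimvS (subvf (S + T)%VS); rewrite dimv_disjoint_sum //.
rewrite dim_span_filter ?(basis_free lb) //.
have -> : \dim {:U} = size l.
  by case/andP: lb => /eqP <- /eqnP ->; rewrite size_map.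
by rewrite -(count_predC (fun p => (p.1 <= b)%R) l) leq_add2r.
Qed.

Lemma size_eigenvalues : size (eigenvalues A) = \dim {:U}.
Proof.
have [l [lE lb]] := spectral_theorem_stable A_sa (subvf (A @: fullv)).
rewrite (perm_size (eigenvalues_eigenbasis lE lb)).
by case/andP: lb => /eqP <- /eqnP ->; rewrite !size_map.
Qed.

End Counting.

Lemma eigenvalues_sorted (U : vectType R) (A : 'End(U)) :
  sorted <=%R (eigenvalues A).
Proof. exact/sort_sorted/le_total. Qed.

(** Take for [b] the k-th eigenvalue of [A] itself: at least k + 1 eigenvalues
    of [A] are at most [b] (indices start from 0), hence so are at least k + 1
    eigenvalues of [B]. *)
Lemma nth_eigenvalues_le (U W : vectType R) (ipU : innerProduct U)
    (ipW : innerProduct W) (A : 'End(U)) (B : 'End(W)) k :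
  adjoint_pair ipU ipU A A -> adjoint_pair ipW ipW B B ->
  (forall b (S : {vspace U}),
    (forall x, x \in S -> ipU (A x) x <= b * ipU x x) ->
    exists S' : {vspace W}, (\dim S <= \dim S')%N /\
      (forall y, y \in S' -> ipW (B y) y <= b * ipW y y)) ->
  (k < \dim {:U})%N -> nth 0 (eigenvalues B) k <= nth 0 (eigenvalues A) k.
Proof.
move=> A_sa B_sa AB kU; set b := nth 0 (eigenvalues A) k.
have [S [dimS SA]] := rayleigh_subspace A_sa b.
have [S' [SS' /(dim_rayleigh_le B_sa) S'B]] := AB _ _ SA.
apply: nth_count_le; first exact: eigenvalues_sorted.
apply: leq_trans S'B; apply: leq_trans SS'; rewrite dimS ltnNge.
apply/negP => ck; have := ltxx b.
rewrite -{2}/b nth_count_gt ?eigenvalues_sorted //.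
by rewrite ck (size_eigenvalues A_sa).
Qed.

(** * Comparison of the operators f f^* *)
Section LaplacianBasics.
Variables (U W : vectType R) (ipU : innerProduct U) (ipW : innerProduct W).

Lemma laplacian_selfadjoint (f : 'Hom(U, W)) g :
  adjoint_pair ipU ipW f g -> adjoint_pair ipW ipW (f \o g)%VF (f \o g)%VF.
Proof.
move=> fg x y; rewrite !comp_lfunE fg.
by rewrite (adjoint_pair_sym fg).
Qed.

Lemma laplacian_form (f : 'Hom(U, W)) g x : adjoint_pair ipU ipW f g ->
  ipW ((f \o g)%VF x) x = ipU (g x) (g x).
Proof. by move=> fg; rewrite comp_lfunE fg. Qed.

End LaplacianBasics.

Section Isometries.
Variables (U1 U : vectType R) (ipU1 : innerProduct U1) (ipU : innerProduct U).

(** The adjoint of an isometric embedding is the orthogonal projection onto its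
    image, hence a contraction: expand |u - j (p u)|^2 >= 0. *)
Lemma adjoint_isometry_le (j : 'Hom(U1, U)) p u : adjoint_pair ipU1 ipU j p ->
  (forall x, ipU (j x) (j x) = ipU1 x x) -> ipU1 (p u) (p u) <= ipU u u.
Proof.
move=> jp ji; have := form_ge0 ipU (u - j (p u)).
rewrite formBr !formBl ji (form_sym ipU u) !jp; lra.
Qed.

Lemma adjoint_isometryK (j : 'Hom(U1, U)) p : adjoint_pair ipU1 ipU j p ->
  (forall x y, ipU (j x) (j y) = ipU1 x y) -> cancel j p.
Proof.
by move=> jp ji x; apply: (@form_inj _ ipU1) => z; rewrite -jp ji.
Qed.

End Isometries.

Section Comparison.
Variables (U W U1 W1 : vectType R).
Variables (ipU : innerProduct U) (ipW : innerProduct W).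
Variables (ipU1 : innerProduct U1) (ipW1 : innerProduct W1).

(** Restricting [f] to a subspace of its domain composes the adjoint with the
    projection onto this subspace and so decreases the quadratic form of
    f f^* everywhere. *)
Lemma laplacian_eigenvalue_subdomain (j : 'Hom(U1, U)) (f : 'Hom(U, W))
    g f1 g1 k :
  adjoint_pair ipU ipW f g -> adjoint_pair ipU1 ipW f1 g1 ->
  (forall x y, ipU (j x) (j y) = ipU1 x y) -> f1 = (f \o j)%VF ->
  (k < \dim {:W})%N ->
  nth 0 (eigenvalues (f1 \o g1)%VF) k <= nth 0 (eigenvalues (f \o g)%VF) k.
Proof.
move=> fg fg1 ji f1E.
have jp := adjoint_pairP ipU1 ipU j; set p := adjoint _ _ _ in jp.
have g1E x : g1 x = p (g x).
  by apply: (@form_inj _ ipU1) => z; rewrite -jp -fg -fg1 f1E comp_lfunE.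
apply: (nth_eigenvalues_le (laplacian_selfadjoint fg)
  (laplacian_selfadjoint fg1)).
move=> b S SA; exists S; split=> // x /SA; apply: le_trans.
rewrite (laplacian_form _ fg) (laplacian_form _ fg1) g1E.
exact: adjoint_isometry_le jp _.
Qed.

(** The last hypothesis on [j] says that its image is the whole preimage under
    [f] of the image of [i]; this makes f1 g1 the Schur complement of f g. It
    does not suffice to compare with the compression of f g to the image of [i],
    since the k-th eigenvalue of the compression is an upper bound for both
    sides. *)
Lemma laplacian_eigenvalue_subcodomain (j : 'Hom(U1, U)) (i : 'Hom(W1, W))
    (f : 'Hom(U, W)) g f1 g1 k :
  adjoint_pair ipU ipW f g -> adjoint_pair ipU1 ipW1 f1 g1 ->
  (forall x y, ipU (j x) (j y) = ipU1 x y) ->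
  (forall x y, ipW (i x) (i y) = ipW1 x y) ->
  (i \o f1 = f \o j)%VF ->
  (forall u w, f u = i w -> exists x, u = j x) ->
  (k < \dim {:W1})%N ->
  nth 0 (eigenvalues (f \o g)%VF) k <= nth 0 (eigenvalues (f1 \o g1)%VF) k.
Proof.
move=> fg fg1 ji ii /lfunP ij uj.
have jp := adjoint_pairP ipU1 ipU j; set p := adjoint _ _ _ in jp.
have ir := adjoint_pairP ipW1 ipW i; set r := adjoint _ _ _ in ir.
have pK := adjoint_isometryK jp ji; have rK := adjoint_isometryK ir ii.
have ijE x : i (f1 x) = f (j x) by have := ij x; rewrite !comp_lfunE.
have pg w : p (g w) = g1 (r w).
  by apply: (@form_inj _ ipU1) => z; rewrite -jp -fg -ijE ir -fg1.
pose N : 'End(W) := (\1 - (i \o r))%VF.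
have NE w : N w = w - i (r w) by rewrite add_lfunE opp_lfunE comp_lfunE lfunE.
have N_sa : adjoint_pair ipW ipW N N.
  move=> x y; rewrite !NE formBl formBr ir.
  by rewrite (adjoint_pair_sym ir).
have fgN : adjoint_pair ipU ipW (N \o f)%VF (g \o N)%VF.
  by move=> u w; rewrite !comp_lfunE N_sa fg.
(* [N \o f] vanishes exactly on the image of [j], and g (i w) - j (g1 w) is
   orthogonal to that image. *)
have lift w : exists z, r z = w /\ g z = j (g1 w).
  have [|y yE] := orthogonal_ker_sub_limg (u := g (i w) - j (g1 w)) fgN.
    move=> u; rewrite comp_lfunE NE => /eqP; rewrite subr_eq0 => /eqP fu.
    have [x ->] := uj _ _ fu.
    by rewrite form_sym jp linearB /= pg rK pK subrr form0r.
  exists (i w - N y); split.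
    by rewrite linearB /= NE linearB /= !rK subrr subr0.
  by move: yE; rewrite comp_lfunE linearB /= => <-; rewrite opprB addrC subrK.
apply: (nth_eigenvalues_le (laplacian_selfadjoint fg1)
  (laplacian_selfadjoint fg)).
move=> b S SA.
pose S' := (g @^-1: limg j :&: r @^-1: S)%VS.
have S'P z : (z \in S') = (g z \in limg j) && (r z \in S).
  by rewrite memv_cap -!memv_preim.
have SS' : (S <= r @: S')%VS.
  apply/subvP => w wS; have [z [zw zg]] := lift w.
  by rewrite -zw memv_img // S'P zw wS zg memv_img ?memvf.
have dimSS' : (\dim S <= \dim S')%N.
  by apply: leq_trans (dimvS SS') _; rewrite -(limg_ker_dim r S') leq_addl.
(* A nonzero S forces b >= 0, which the last step needs to replace the norm of
   the projection by the larger norm of z. *)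
have [S0|/eqP S0] := eqVneq S 0%VS.
  exists 0%VS; rewrite S0; split=> [|y]; rewrite ?dimv0 // memv0.
  by move=> /eqP ->; rewrite !form0r mulr0.
have b_ge0 : 0 <= b.
  move/eqP: S0; rewrite -vpick0 => v0; have := SA _ (memv_pick S).
  rewrite (laplacian_form _ fg1) => /(le_trans (form_ge0 _ _)).
  by rewrite pmulr_lge0 // form_gt0.
exists S'; split=> // z; rewrite S'P => /andP[/memv_imgP[x _ gz] /SA].
have xE : x = g1 (r z) by rewrite -pg gz pK.
rewrite (laplacian_form _ fg1) (laplacian_form _ fg) gz ji -xE.
move=> /le_trans; apply.
by rewrite ler_wpM2l // (adjoint_isometry_le _ ir).
Qed.

End Comparison.
End InnerProducts.

(** * Chain spaces of simplicial pairs *)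
Section Chains.
Variables (R : realType) (d : Order.disp_t) (V : finOrderType d).
Local Notation ambient := {ffun {set V} -> R^o}.
Implicit Types K L : wcomplex R V.

Definition chain_form K q (X : {vspace ambient}) (XK : (X <= chain K q)%VS) :
    innerProduct (subvs_of X) :=
  InnerProduct (@inner_on_sym _ _ _ K X) (@inner_on_linear _ _ _ K X)
    (fun x => @inner_on_gt0 _ _ _ K q X x XK).

Definition inclusion (X Y : {vspace ambient}) : 'Hom(subvs_of X, subvs_of Y) :=
  (linfun (vsproj Y) \o linfun vsval)%VF.

Lemma inclusionE (X Y : {vspace ambient}) x :
  (X <= Y)%VS -> vsval (inclusion X Y x) = vsval x.
Proof.
move=> XY; rewrite comp_lfunE !lfunE /= vsprojK //.
exact: (subvP XY _ (subvsP x)).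
Qed.

Lemma dim_chain K q : \dim (chain K q) = #|qsimplices K q|.
Proof.
rewrite /chain; set s := [seq _ | _ <- _].
suff /eqnP -> : free s by rewrite size_map -cardE.
rewrite -[s]/(tval (in_tuple s)); apply/freeP => c c0 i.
have si k : (k < size s)%N ->
      s`_k = oriented R (nth finset.set0 (enum (qsimplices K q)) k).
  by rewrite size_map => ks; rewrite (nth_map finset.set0).
have /ffunP/(_ (nth finset.set0 (enum (qsimplices K q)) i)) := c0.
rewrite sum_ffunE ffunE (bigD1 i) //= big1 ?addr0 => [|k ki].
  by rewrite ffunE si // ffunE eqxx -[_ *: _]/(_ * _) mulr1.
have szE : size (enum (qsimplices K q)) = size s by rewrite size_map.
rewrite ffunE si // ffunE nth_uniq ?enum_uniq ?szE //.
by rewrite eq_sym [(_ == _)](negbTE ki) scaler0.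
Qed.

Lemma chain_sub K L q : simplicial_pair K L -> (chain K q <= chain L q)%VS.
Proof.
case=> /fintype.subsetP KL _; apply: sub_span => _ /mapP[s + ->].
rewrite mem_enum inE => /andP[sK sq].
by rewrite map_f // mem_enum inE KL.
Qed.

(** A chain of [K] vanishes on the simplices of [L] that are not in [K], and on
    those of [K] the two weights agree. *)
Lemma inner_pair K L q (x y : ambient) : simplicial_pair K L ->
  x \in chain K q -> inner L x y = inner K x y.
Proof.
case=> KL wKL xK; rewrite /inner [LHS](big_setID (simplices K)) /=.
rewrite [X in _ + X]big1 ?addr0 => [|s].
  by rewrite (finset.setIidPr KL); apply: eq_bigr => s sK; rewrite wKL.
by rewrite inE => /andP[sK _]; rewrite (chain_supp xK sK) !mul0r.
Qed.

Lemma pchain_subl K L M q :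
  simplicial_pair L M -> (pchain L K q <= pchain M K q)%VS.
Proof. by move=> LM; apply: capvS; rewrite ?subvv // chain_sub. Qed.

Lemma pchain_subr K L M q :
  simplicial_pair K L -> (pchain M K q <= pchain M L q)%VS.
Proof. by move=> KL; apply: capvS; rewrite ?subvv // lpreimS // chain_sub. Qed.

Lemma mem_pchain K L q (c : ambient) :
  (c \in pchain L K q) = (c \in chain L q.+1) && (boundary R V c \in chain K q).
Proof. by rewrite memv_cap -memv_preim. Qed.

Let pform L K q : innerProduct (subvs_of (pchain L K q)) :=
  chain_form (X := pchain L K q) (capvSl _ _).
Let cform K q := chain_form (subvv (chain K q)).

Lemma pboundary_adjoint K L q : adjoint_pair (pform L K q) (cform K q)
  (pboundary L K q)
  (adjoint (@inner_on _ _ _ L _) (@inner_on _ _ _ K _) (pboundary L K q)).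
Proof. exact: pboundary_adjointP. Qed.

(** The chains of [L] with boundary in [K] form a subspace of those of [M]; the
    codomain is [chain K q] in both cases. *)
Lemma up_eigenvalue_le_ambient K L M q k :
  simplicial_pair L M -> (0 < k <= #|qsimplices K q|)%N ->
  up_eigenvalue K L q k <= up_eigenvalue K M q k.
Proof.
case: k => // k LM kK.
have sub := pchain_subl K q LM.
apply: (laplacian_eigenvalue_subdomain (j := inclusion _ _)
  (@pboundary_adjoint K M q) (@pboundary_adjoint K L q)).
- move=> x y; rewrite /= /inner_on !inclusionE //.
  by apply: inner_pair LM _; exact: (subvP (capvSl _ _) _ (subvsP x)).
- apply/lfunP => x; rewrite [RHS]comp_lfunE; apply: subvs_inj.
  by rewrite !pboundaryE inclusionE.
- by rewrite dimvf /dim /= dim_chain.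
Qed.

(** The chains of [M] with boundary in [K] are precisely the preimage of
    [chain K q] among the chains with boundary in [L]. *)
Lemma up_eigenvalue_le_sub K L M q k :
  simplicial_pair K L -> (0 < k <= #|qsimplices K q|)%N ->
  up_eigenvalue L M q k <= up_eigenvalue K M q k.
Proof.
case: k => // k KL kK.
have psub := pchain_subr M q KL; have csub := chain_sub q KL.
apply: (laplacian_eigenvalue_subcodomain (j := inclusion _ _)
  (i := inclusion _ _)
  (@pboundary_adjoint L M q) (@pboundary_adjoint K M q)).
- by move=> x y; rewrite /= /inner_on !inclusionE //.
- move=> x y; rewrite /= /inner_on !inclusionE //.
  by apply: inner_pair KL _; exact: subvsP.
- apply/lfunP => x; rewrite [LHS]comp_lfunE [RHS]comp_lfunE.
  by apply: subvs_inj; rewrite inclusionE // !pboundaryE inclusionE.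
- move=> u w /(congr1 vsval); rewrite pboundaryE inclusionE // => uw.
  have uK : vsval u \in pchain M K q.
    rewrite mem_pchain uw subvsP andbT.
    exact: (subvP (capvSl _ _) _ (subvsP u)).
  exists (vsproj _ (vsval u)); apply: subvs_inj.
  by rewrite inclusionE // vsprojK.
- by rewrite dimvf /dim /= dim_chain.
Qed.

End Chains.
End UpLaplacianMonotonicity.

Theorem theorem5p2 (R : realType) (d : Order.disp_t) (V : finOrderType d)
    (T : set R) (K : R -> wcomplex R V) (hK : simplicial_filtration T K)
    (q : nat) (t1 t2 t3 : R) (hT1 : T t1) (hT2 : T t2) (hT3 : T t3)
    (h12 : t1 <= t2) (h23 : t2 <= t3)
    (k : nat) (hk : (1 <= k <= #|qsimplices (K t1) q|)%N) :
  up_eigenvalue (K t1) (K t2) q k <= up_eigenvalue (K t1) (K t3) q k /\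
  up_eigenvalue (K t2) (K t3) q k <= up_eigenvalue (K t1) (K t3) q k.
Proof.
split; first by apply: up_eigenvalue_le_ambient; [exact: hK|].
by apply: up_eigenvalue_le_sub; [exact: hK|].
Qed.
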